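(* Let $H$ be an $N\times N$ Hermitian matrix with simple eigenvalues $\mu_1,\dots,\mu_N$ and associated unit eigenvectors $u_1,\dots,u_N$, let $v\in\mathbb{C}^N$ be a unit vector, and let $G_t := H + i t\, vv^*$ for $t\ge0$. Let $\lambda_1(t),\dots,\lambda_N(t)$ be the eigenvalues of $G_t$, indexed so that they form continuous trajectories with initial condition $\lambda_j(0)=\mu_j$. Then $$\lambda_j'(0) = i\,|v^*u_j|^2 \quad \text{for all } j,$$ and for every $t>0$ at which the eigenvalues $\lambda_1(t),\dots,\lambda_N(t)$ are distinct, $$\lambda_j'(t) = \frac{i\,\Im \lambda_j(t)}{t}\prod_{k\neq j}\left(1 + \frac{2i\,\Im\lambda_k(t)}{\lambda_j(t)-\lambda_k(t)}\right) \quad \text{for all } j.$$ *)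

(* Defs.v *)
From HB Require Import structures.
From mathcomp Require Import all_boot all_order all_algebra.
From mathcomp Require Import all_classical all_reals.
From mathcomp Require Import topology normedtype.
From mathcomp Require Import complex.
Set Implicit Arguments. Unset Strict Implicit. Unset Printing Implicit Defensive.
Import Order.TTheory GRing.Theory Num.Theory.
Import numFieldTopology.Exports numFieldNormedType.Exports.
Local Open Scope ring_scope.
Local Open Scope complex_scope.

Definition ctrans (R : realType) (m n : nat) (M : 'M[R[i]]_(m, n)) : 'M[R[i]]_(n, m) :=
  map_mx (@conjc R) M^T.

Definition is_hermitian (R : realType) (N : nat) (H : 'M[R[i]]_N) : Prop := ctrans H = H.

Definition unit_vec (R : realType) (N : nat) (v : 'cV[R[i]]_N) : Prop :=
  (ctrans v *m v) 0 0 = 1.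

Definition Gt (R : realType) (N : nat) (H : 'M[R[i]]_N) (v : 'cV[R[i]]_N) (t : R)
  : 'M[R[i]]_N := H + ('i * t%:C) *: (v *m ctrans v).

Definition iC (R : realType) : R[i] := 'i.
Definition RC (R : realType) (t : R) : R[i] := t%:C.
Definition ImC (R : realType) (z : R[i]) : R := complex.Im z.
Definition absC2 (R : realType) (z : R[i]) : R := complex.Re z ^+ 2 + complex.Im z ^+ 2.

(* Equip R[i] with its usual (modulus) metric topology, as a numClosedFieldType. *)
Definition Cn (R : rcfType) : numClosedFieldType := R[i].
HB.instance Definition _ (R : rcfType) := PseudoPointedMetric.copy R[i] (Cn R)^o.

(* Main.v *)
Require Import Defs.
From HB Require Import structures.
From mathcomp Require Import all_boot all_order all_algebra.
From mathcomp Require Import all_classical all_reals.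
From mathcomp Require Import topology normedtype.
From mathcomp Require Import complex ring.
Import Order.TTheory GRing.Theory Num.Theory.
Import numFieldTopology.Exports numFieldNormedType.Exports.
Local Open Scope ring_scope.
Local Open Scope classical_set_scope.

(** The characteristic polynomial of G_t is p - i t q, where
    p = prod_k (X - mu_k) and q = sum_k |v^* u_k|^2 prod_(l != k) (X - mu_l)
    are real and do not depend on t.  Since p = i (t + h) q at lambda_j(t + h),
      (lambda_j(t + h) - lambda_j(t)) prod_(k != j) (lambda_j(t + h) - lambda_k(t))
        = (p - i t q)(lambda_j(t + h)) = i h q(lambda_j(t + h)),
    so dividing by h and letting h -> 0 gives
      lambda_j'(t) = i q(lambda_j(t)) / prod_(k != j) (lambda_j(t) - lambda_k(t)).
    At t = 0 the value of q at mu_j is explicit.  For t > 0 complex conjugation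
    gives p + i t q = prod_k (X - conj lambda_k), which determines
    q(lambda_j(t)). *)

(** * Determinants and characteristic polynomials under rank-one perturbation *)

(* Compare the determinants in
   [[adj A, 0], [- y adj A, det A]] * [[A, - x], [y, 1]]
     = [[det A, - adj A x], [0, det A + y adj A x]]
   and cancel the power of det A. *)
Lemma det_add_rank1 (K : idomainType) (n : nat) (A : 'M[K]_n)
    (x : 'cV[K]_n) (y : 'rV[K]_n) : \det A != 0 ->
  \det (A + x *m y) = \det A + (y *m \adj A *m x) 0 0.
Proof.
move=> A0; set d := \det A in A0 *.
have eqB : block_mx A (- x) y 1%:M *m block_mx 1%:M 0 (- y) 1%:M
    = block_mx (A + x *m y) (- x) 0 1%:M.
  rewrite mulmx_block !mulmx1 !mulmx0 !mul1mx !add0r mulNmx mulmxN opprK.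
  by rewrite subrr.
have detB : \det (block_mx A (- x) y 1%:M) = \det (A + x *m y).
  have := congr1 (fun M => \det M) eqB.
  by rewrite det_mulmx det_lblock det_ublock !det1 !mulr1.
have eqL : block_mx (\adj A) 0 (- (y *m \adj A)) d%:M
      *m block_mx A (- x) y 1%:M
    = block_mx d%:M (- (\adj A *m x)) 0 (d%:M + y *m \adj A *m x).
  rewrite mulmx_block !mul0mx !addr0 !mulmx1 !(mulNmx, mulmxN) opprK.
  rewrite -[y *m _ *m A]mulmxA mul_adj_mx -/d mul_mx_scalar mul_scalar_mx.
  by rewrite addNr [_ + d%:M]addrC.
have := congr1 (fun M => \det M) eqL.
rewrite det_mulmx det_lblock det_ublock detB !det_scalar1 !det_scalar.
rewrite [X in d ^+ n * X]det_mx11 !mxE eqxx mulr1n => eqd.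
have dn : d ^+ n = \det (\adj A) * d.
  by rewrite -det_scalar -mul_adj_mx det_mulmx.
apply: (mulfI (expf_neq0 n A0)); rewrite -eqd dn; ring.
Qed.

(** [det_add_rank1] applies over [{poly K}] to the diagonal matrix with entries ['X - d 0 k]: its
    determinant is a nonzero polynomial even when entries of [d] coincide, and its adjugate is
    diagonal. *)
Lemma char_poly_diag_add_rank1 (K : fieldType) (n : nat) (d : 'rV[K]_n)
    (x : 'cV[K]_n) (y : 'rV[K]_n) :
  char_poly (diag_mx d + x *m y) = \prod_k ('X - (d 0 k)%:P)
    - \sum_k (y 0 k * x k 0) *: \prod_(l | l != k) ('X - (d 0 l)%:P).
Proof.
set e : 'rV[{poly K}]_n := \row_k ('X - (d 0 k)%:P).
have ek k : e 0 k != 0 by rewrite mxE polyXsubC_eq0.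
have -> : char_poly (diag_mx d + x *m y)
    = \det (diag_mx e + (- map_mx polyC x) *m map_mx polyC y).
  congr (\det _); rewrite /char_poly_mx map_mxD map_mxM mulNmx opprD addrA.
  congr (_ - _); apply/matrixP => i j; rewrite !mxE.
  by case: eqVneq => _; rewrite ?mulr1n ?mulr0n ?subr0 ?polyC0 ?subr0.
have de : \det (diag_mx e) = \prod_k ('X - (d 0 k)%:P).
  by rewrite det_diag; apply: eq_bigr => k _; rewrite mxE.
have e0 : \det (diag_mx e) != 0.
  by rewrite det_diag; apply/prodf_neq0 => k _.
rewrite det_add_rank1 // de; congr (_ + _).
have adjE : \adj (diag_mx e)
    = diag_mx (\row_k \prod_(l | l != k) ('X - (d 0 l)%:P)).
  apply/matrixP => i j.
  (* The adjugate is read off from adj D * D = det D by cancelling the nonzero factor [e 0 j],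
     without expanding cofactors. *)
  have /matrixP/(_ i j) := mul_adj_mx (diag_mx e).
  rewrite mul_mx_diag !mxE de => eqij; apply: (mulIf (ek j)).
  rewrite !mxE eqij; case: eqVneq => [->|_]; last by rewrite !mulr0n mul0r.
  by rewrite !mulr1n (bigD1 j) //= mulrC.
rewrite adjE mul_mx_diag !mxE -sumrN; apply: eq_bigr => k _.
rewrite !mxE mulrN; congr (- _).
by rewrite mulrAC -polyCM mul_polyC.
Qed.

Lemma char_poly_conj (K : comUnitRingType) (n : nat) (P Q A : 'M[K]_n) :
  Q *m P = 1%:M -> char_poly (P *m A *m Q) = char_poly A.
Proof.
move=> QP; have PQ := mulmx1C QP; rewrite /char_poly.
have -> : char_poly_mx (P *m A *m Q)
    = map_mx polyC P *m char_poly_mx A *m map_mx polyC Q.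
  rewrite /char_poly_mx mulmxBr mulmxBl -!map_mxM; congr (_ - _).
  by rewrite -mulmxA mul_scalar_mx -scalemxAr -map_mxM PQ map_mx1 scalemx1.
by rewrite !det_mulmx mulrAC -det_mulmx -map_mxM PQ map_mx1 det1 mul1r.
Qed.

(** * Conjugate transposes and the eigenbasis of a Hermitian matrix *)

Lemma ctransM (R : realType) (m n p : nat) (A : 'M[R[i]]_(m, n))
    (B : 'M[R[i]]_(n, p)) :
  ctrans (A *m B) = ctrans B *m ctrans A.
Proof. by rewrite /ctrans trmx_mul map_mxM. Qed.

Lemma ctransK (R : realType) (m n : nat) (A : 'M[R[i]]_(m, n)) : ctrans (ctrans A) = A.
Proof. by apply/matrixP => i j; rewrite !mxE conjcK. Qed.

Lemma ctransZ (R : realType) (m n : nat) (a : R[i]) (A : 'M[R[i]]_(m, n)) :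
  ctrans (a *: A) = conjc a *: ctrans A.
Proof. by apply/matrixP => i j; rewrite !mxE rmorphM. Qed.

Section Spectral.
Context (R : realType) (N : nat) (H : 'M[R[i]]_N) (mu : 'I_N -> R[i])
  (u : 'I_N -> 'cV[R[i]]_N).
Hypotheses (Hherm : is_hermitian H) (Hu : forall j, H *m u j = mu j *: u j)
  (u1 : forall j, unit_vec (u j)).

(** Both sides are u_j^* H u_k, with [H] acting on the right vector or on the left one. The case j =
    k yields real eigenvalues, the case j != k orthogonality. *)
Lemma hermitian_eigen_dot (j k : 'I_N) :
  mu k * (ctrans (u j) *m u k) 0 0 = conjc (mu j) * (ctrans (u j) *m u k) 0 0.
Proof.
have : ctrans (u j) *m (H *m u k) = ctrans (H *m u j) *m u k.
  by rewrite ctransM Hherm mulmxA.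
rewrite !Hu ctransZ -scalemxAr -scalemxAl => /matrixP/(_ 0 0).
by rewrite mxE [RHS]mxE.
Qed.

Lemma hermitian_eigen_real (j : 'I_N) : conjc (mu j) = mu j.
Proof. by have := hermitian_eigen_dot j j; rewrite u1 !mulr1. Qed.

Hypothesis mu_inj : injective mu.

Lemma hermitian_eigen_orthonormal (j k : 'I_N) :
  (ctrans (u j) *m u k) 0 0 = (j == k)%:R.
Proof.
have [<-|jk] := eqVneq j k; first exact: u1.
have /eqP := hermitian_eigen_dot j k.
rewrite hermitian_eigen_real -subr_eq0 -mulrBl mulf_eq0 subr_eq0.
by case/orP => /eqP // /mu_inj kj; rewrite kj eqxx in jk.
Qed.

(** In the orthonormal eigenbasis U, the matrix G_t becomes diag(mu) + i t w w^* with w = U^* v, and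
    |w_k|^2 = |v^* u_k|^2. *)
Lemma char_poly_Gt (v : 'cV[R[i]]_N) (t : R) :
  char_poly (Gt H v t) = \prod_k ('X - (mu k)%:P)
    - (iC R * RC t) *: \sum_k RC (absC2 ((ctrans v *m u k) 0 0)) *:
        \prod_(l | l != k) ('X - (mu l)%:P).
Proof.
pose U : 'M[R[i]]_N := \matrix_(i, j) u j i 0.
pose d : 'rV[R[i]]_N := \row_k mu k.
have UU : ctrans U *m U = 1%:M.
  apply/matrixP => j k; rewrite [RHS]mxE -hermitian_eigen_orthonormal !mxE.
  by apply: eq_bigr => l _; rewrite !mxE.
have UU' := mulmx1C UU.
have HU : H *m U = U *m diag_mx d.
  apply/matrixP => i j; rewrite mul_mx_diag !mxE mulrC.
  have /matrixP/(_ i 0) := Hu j; rewrite !mxE => <-.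
  by apply: eq_bigr => l _; rewrite !mxE.
pose w := ctrans U *m v.
have GE : Gt H v t
    = U *m (diag_mx d + w *m ((iC R * RC t) *: ctrans w)) *m ctrans U.
  rewrite mulmxDr mulmxDl -HU -mulmxA UU' mulmx1; congr (_ + _).
  rewrite -scalemxAr -scalemxAr -scalemxAl; congr (_ *: _).
  rewrite /w ctransM ctransK !mulmxA UU' mul1mx.
  by rewrite -[RHS]mulmxA UU' mulmx1.
rewrite GE (char_poly_conj _ _ _ _ _ UU) char_poly_diag_add_rank1.
congr (_ - _).
  by apply: eq_bigr => k _; rewrite mxE.
rewrite scaler_sumr; apply: eq_bigr => k _; rewrite scalerA; congr (_ *: _).
  have wk : ctrans w 0 k = (ctrans v *m u k) 0 0.
    rewrite /w ctransM ctransK !mxE.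
    by apply: eq_bigr => l _; rewrite !mxE.
  have wk' : w k 0 = conjc ((ctrans v *m u k) 0 0).
    by rewrite -wk !mxE conjcK.
  rewrite [X in X * _]mxE wk wk' -[LHS]mulrA.
  congr (_ * _).
  case: (_ 0 0) => a b; rewrite /RC /absC2 /=.
  by apply/eqP; rewrite eq_complex /=; apply/andP; split; apply/eqP; ring.
by apply: eq_bigr => l _; rewrite mxE.
Qed.

End Spectral.

(** * Limits of difference quotients at a simple root *)

Section Limits.
Context (K : numFieldType) (T : Type) (F : set_system T) {FF : Filter F}.

Lemma cvg_horner (p : {poly K}) (x : T -> K) (a : K) :
  x @ F --> a -> (fun s => p.[x s]) @ F --> p.[a].
Proof.
move=> xa; elim/poly_ind: p => [|p c IHp].
  by rewrite horner0; under eq_fun do rewrite horner0; exact: cvg_cst.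
rewrite hornerMXaddC; under eq_fun do rewrite hornerMXaddC.
by apply: cvgD; [apply: cvgM | exact: cvg_cst].
Qed.

(** Here [e] is the increment of the parameter and [r] the cofactor of 'X - a. By continuity
    [r.[x s]] is eventually nonzero, so the equation can be divided by both [e s] and [r.[x s]]. *)
Lemma cvg_quotient_simple_root (x e : T -> K) (a c : K) (r q : {poly K}) :
  x @ F --> a -> r.[a] != 0 ->
  (\forall s \near F, e s != 0) ->
  (\forall s \near F, (x s - a) * r.[x s] = e s * (c * q.[x s])) ->
  (fun s => (e s)^-1 * (x s - a)) @ F --> c * q.[a] / r.[a].
Proof.
move=> xa ra e0 eqx.
have rx0 : \forall s \near F, r.[x s] != 0.
  exact: cvgr_neq0 (cvg_horner r _ _ xa) ra.
apply: cvg_trans (_ : (fun s => c * q.[x s] / r.[x s]) @ F --> _); last first.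
  apply: cvgM; last by apply: cvgV => //; exact: cvg_horner.
  by apply: cvgM; [exact: cvg_cst | exact: cvg_horner].
apply: near_eq_cvg; near=> s.
have es : e s != 0 by near: s.
have rs : r.[x s] != 0 by near: s.
apply: (mulIf rs); rewrite divfK // -mulrA; apply: (mulfI es).
rewrite mulrA divff // mul1r; symmetry.
by near: s.
Unshelve. all: by end_near. Qed.

End Limits.

Section NonnegativeHalfLine.
Context (R : realType) (f : R -> R[i]).
Hypothesis fc : {within [set t : R | 0 <= t], continuous f}.

Lemma within_nneg_cvg_right : f @ 0^'+ --> (f 0 : R[i]).
Proof.
move/subspace_continuousP: fc => /(_ 0 (lexx _)) f0.
apply: cvg_trans f0; apply: cvg_app; apply: within_subset => s /=.
exact: ltW.
Qed.

Lemma within_nneg_cvg_shift (t : R) : 0 < t ->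
  (fun h => f (t + h)) @ 0^' --> (f t : R[i]).
Proof.
move=> t0; move/subspace_continuousP: fc => /(_ t (ltW t0)).
(* Since t > 0 is interior to the half-line, the restricted limit is a two-sided one. *)
rewrite within_interior; last first.
  rewrite /interior /=; near=> s; apply: ltW; near: s.
  by apply: (cvgr_gt t) => //; exact: cvg_id.
move=> ft; apply: cvg_within_filter.
apply: (@cvg_comp _ _ _ (fun h => t + h) f _ (nbhs t)); last exact: ft.
have : (fun h => t + h) @ (0 : R) --> t + 0.
  by apply: cvgD; [exact: cvg_cst | exact: cvg_id].
by rewrite addr0.
Unshelve. all: by end_near. Qed.

End NonnegativeHalfLine.

(** Evaluating the factorization at time t at the root [x h] of p - i (t + h) q leaves (x h - a) r(x
    h) = i h q(x h). *)
Lemma cvg_secular_root (R : realType) (F : set_system R) {FF : Filter F}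
    (x : R -> R[i]) (t : R) (a : R[i]) (p q r : {poly R[i]}) :
  x @ F --> a -> r.[a] != 0 ->
  p - (iC R * RC t) *: q = ('X - a%:P) * r ->
  (\forall h \near F, h != 0) ->
  (\forall h \near F, p.[x h] = iC R * RC (t + h) * q.[x h]) ->
  (fun h => (RC h)^-1 * (x h - a)) @ F --> iC R * q.[a] / r.[a].
Proof.
move=> xa ra pqr h0 ph.
apply: (@cvg_quotient_simple_root (Cn R)) => //.
  by apply: filterS h0 => h; rewrite fmorph_eq0.
apply: filterS ph => h ph.
have := congr1 (fun P => P.[x h]) pqr.
rewrite hornerM hornerXsubC hornerD hornerN hornerZ ph => <-.
by rewrite /RC rmorphD /=; ring.
Qed.

(** * Complex conjugation and the value of [q] at an eigenvalue *)

Lemma sub_conjc (R : realType) (x y : R[i]) :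
  x - conjc y = x - y + RC 2 * iC R * RC (ImC y).
Proof.
case: x y => [a b] [c d]; apply/eqP; rewrite eq_complex /=.
by apply/andP; split; apply/eqP; ring.
Qed.

Lemma conjc_RC (R : realType) (a : R) : conjc (RC a) = RC a.
Proof. by rewrite /RC /= oppr0. Qed.

Lemma map_conjc_prodXsubC (R : realType) (I : finType) (P : pred I)
    (a : I -> R[i]) :
  map_poly (@conjc R) (\prod_(k | P k) ('X - (a k)%:P))
  = \prod_(k | P k) ('X - (conjc (a k))%:P).
Proof.
rewrite rmorph_prod; apply: eq_bigr => k _.
by rewrite rmorphB /= map_polyX map_polyC.
Qed.

(* With p - i t q = prod (X - lambda_k) and p, q real, conjugation gives
   2 i t q = prod (X - conj lambda_k) - prod (X - lambda_k). *)
Lemma secular_horner_root (R : realType) (N : nat) (p q : {poly R[i]}) (t : R)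
    (a : 'I_N -> R[i]) (j : 'I_N) :
  map_poly (@conjc R) p = p -> map_poly (@conjc R) q = q -> t != 0 ->
  p - (iC R * RC t) *: q = \prod_k ('X - (a k)%:P) ->
  q.[a j] = RC (ImC (a j)) / RC t
    * \prod_(k | k != j) (a j - a k + RC 2 * iC R * RC (ImC (a k))).
Proof.
move=> pr qr t0 pq.
have pq' : p + (iC R * RC t) *: q = \prod_k ('X - (conjc (a k))%:P).
  rewrite -map_conjc_prodXsubC -pq rmorphB /= map_polyZ pr qr /=.
  rewrite -scaleNr; congr (_ + _ *: _).
  by apply/eqP; rewrite eq_complex /=; apply/andP; split; apply/eqP; ring.
have /(congr1 (fun P => P.[a j])) : (RC 2 * iC R * RC t) *: q
    = \prod_k ('X - (conjc (a k))%:P) - \prod_k ('X - (a k)%:P).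
  rewrite -pq -pq' opprB addrC subrKA -scalerDl; congr (_ *: _).
  by rewrite (_ : RC 2 = 1 + 1) ?/RC ?rmorphD ?rmorph1 //; ring.
rewrite hornerZ hornerD hornerN !horner_prod.
under eq_bigr do rewrite hornerXsubC sub_conjc.
(* The factor k = j kills the second product and contributes 2 i Im(a_j) to the first. *)
rewrite (bigD1 j) //= [X in _ - X](bigD1 j) //= hornerXsubC !subrr mul0r subr0.
rewrite add0r => eqq.
have i0 : RC 2 * iC R != 0.
  by rewrite mulf_neq0 ?fmorph_eq0 ?pnatr_eq0 // eq_complex /= oner_eq0 andbF.
have t0' : RC t != 0 by rewrite fmorph_eq0.
apply: (mulfI (mulf_neq0 i0 t0')); rewrite eqq; field.
exact: t0'.
Qed.

(** * Derivatives of the eigenvalue trajectories *)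

Theorem theorem1p5 (R : realType) (N : nat)
  (H : 'M[R[i]]_N) (mu : 'I_N -> R[i]) (u : 'I_N -> 'cV[R[i]]_N) (v : 'cV[R[i]]_N)
  (lambda : 'I_N -> R -> R[i]) :
  is_hermitian H ->
  injective mu ->
  (forall j, H *m u j = mu j *: u j) ->
  (forall j, unit_vec (u j)) ->
  unit_vec v ->
  (forall t, 0 <= t -> char_poly (Gt H v t) = \prod_(j < N) ('X - (lambda j t)%:P)) ->
  (forall j, {within [set t : R | 0 <= t], continuous (lambda j)}) ->
  (forall j, lambda j 0 = mu j) ->
  (forall j,
     (fun h : R => (RC h)^-1 * (lambda j h - lambda j 0)) @ 0^'+ -->
       iC R * RC (absC2 ((ctrans v *m u j) 0 0))) /\
  (forall t, 0 < t -> injective (fun k => lambda k t) ->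
   forall j,
     (fun h : R => (RC h)^-1 * (lambda j (t + h) - lambda j t)) @ 0^' -->
       iC R * RC (ImC (lambda j t)) / RC t *
       \prod_(k < N | k != j)
          (1 + (RC 2 * iC R * RC (ImC (lambda k t))) / (lambda j t - lambda k t))).
Proof.
move=> Hh mu_inj Hu u1 v1 lamE lamc lam0.
set p : {poly R[i]} := \prod_k ('X - (mu k)%:P).
set q : {poly R[i]} := \sum_k RC (absC2 ((ctrans v *m u k) 0 0)) *:
        \prod_(l | l != k) ('X - (mu l)%:P).
have pqE t : 0 <= t ->
    p - (iC R * RC t) *: q = \prod_(k < N) ('X - (lambda k t)%:P).
  by move=> t0; rewrite -lamE // (char_poly_Gt _ _ _ _ _ Hh Hu u1 mu_inj).
have mur k : conjc (mu k) = mu k by exact: hermitian_eigen_real Hh Hu u1 k.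
have pr : map_poly (@conjc R) p = p.
  by rewrite map_conjc_prodXsubC; apply: eq_bigr => k _; rewrite mur.
have qr : map_poly (@conjc R) q = q.
  rewrite rmorph_sum; apply: eq_bigr => k _ /=.
  rewrite map_polyZ map_conjc_prodXsubC; congr (_ *: _); first exact: conjc_RC.
  by apply: eq_bigr => l _; rewrite mur.
have lam_root j t : 0 <= t ->
    p.[lambda j t] = iC R * RC t * q.[lambda j t].
  move=> t0; apply/eqP; rewrite -subr_eq0 -hornerZ -hornerN -hornerD pqE //.
  by rewrite horner_prod (bigD1 j) //= hornerXsubC subrr mul0r.
(* The filter is left arbitrary to cover both the right-hand limit at t = 0 and the two-sided limit
   at t > 0. *)
have lim (F : set_system R) (FF : Filter F) j t : 0 <= t ->
    injective (fun k => lambda k t) ->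
    (fun h => lambda j (t + h)) @ F --> lambda j t ->
    (\forall h \near F, h != 0) -> (\forall h \near F, 0 <= t + h) ->
    (fun h => (RC h)^-1 * (lambda j (t + h) - lambda j t)) @ F -->
      iC R * q.[lambda j t]
        / \prod_(k < N | k != j) (lambda j t - lambda k t).
  move=> t0 inj cvgj h0 th0.
  pose r := \prod_(k < N | k != j) ('X - (lambda k t)%:P).
  have rE : r.[lambda j t] = \prod_(k < N | k != j) (lambda j t - lambda k t).
    by rewrite horner_prod; apply: eq_bigr => k _; rewrite hornerXsubC.
  rewrite -rE; apply: (@cvg_secular_root _ _ _ _ t _ p) => //.
  - rewrite rE; apply/prodf_neq0 => k kj; rewrite subr_eq0.
    by apply: contraNneq kj => /inj ->.
  - by rewrite pqE // (bigD1 j).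
  - by apply: filterS th0 => h; exact: lam_root.
split=> [j|t t0 inj j].
  have inj0 : injective (fun k => lambda k 0).
    by move=> k l; rewrite !lam0 => /mu_inj.
  have qE : q.[lambda j 0] = RC (absC2 ((ctrans v *m u j) 0 0))
      * \prod_(k < N | k != j) (lambda j 0 - lambda k 0).
    (* Each summand k != j of [q] contains the factor 'X - mu_j and so vanishes at lambda_j(0) =
       mu_j. *)
    rewrite horner_sum (bigD1 j) //= [X in _ + X]big1 => [|k kj]; last first.
      rewrite hornerZ horner_prod (bigD1 j) 1?eq_sym //= lam0 hornerXsubC.
      by rewrite subrr mul0r mulr0.
    rewrite addr0 hornerZ horner_prod; congr (_ * _).
    by apply: eq_bigr => k _; rewrite hornerXsubC !lam0.
  have d0 : \prod_(k < N | k != j) (lambda j 0 - lambda k 0) != 0.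
    apply/prodf_neq0 => k kj; rewrite subr_eq0.
    by apply: contraNneq kj => /inj0 ->.
  have shift0 : (fun h => lambda j (0 + h)) = lambda j.
    by apply/funext => h; rewrite add0r.
  have := lim 0^'+ _ j 0 (lexx 0) inj0.
  rewrite shift0 qE -mulrA mulfK //.
  under [X in _ -> _ -> _ -> X @ _ --> _]eq_fun do rewrite add0r.
  apply; first exact: within_nneg_cvg_right.
    by near=> h; rewrite gt_eqF.
  by near=> h; rewrite add0r ltW.
have limE : iC R * RC (ImC (lambda j t)) / RC t *
       \prod_(k < N | k != j)
          (1 + (RC 2 * iC R * RC (ImC (lambda k t))) / (lambda j t - lambda k t))
    = iC R * q.[lambda j t]
        / \prod_(k < N | k != j) (lambda j t - lambda k t).
  rewrite (secular_horner_root _ _ _ _ _ _ j pr qr (lt0r_neq0 t0) (pqE t (ltW t0))).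
  (* Dividing factor by factor turns a_j - a_k + 2 i Im(a_k) into 1 + 2 i Im(a_k) / (a_j - a_k). *)
  rewrite !mulrA -[RHS]mulrA -prodf_div; congr (_ * _).
  apply: eq_bigr => k kj; rewrite mulrDl divff // subr_eq0.
  by apply: contraNneq kj => /inj ->.
rewrite limE; apply: lim => //; first exact: ltW.
- exact: within_nneg_cvg_shift.
- exact: nbhs_dnbhs_neq.
- apply: nbhs_dnbhs; near=> h; rewrite -lerBlDl sub0r; apply: ltW; near: h.
  by apply: (cvgr_gt 0); [exact: cvg_id | rewrite oppr_lt0].
Unshelve. all: by end_near. Qed.
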